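(* Let $f=\frac1M\sum_{i=1}^M f_i$ where each $f_i:\mathbb{R}^n\to\mathbb{R}$ is continuously differentiable, and suppose that $f$ has a minimizer $x_*$, that $\nabla f$ is Lipschitz continuous with constant $L>0$, and that $f$ is strongly convex with parameter $\mu>0$. Suppose that there are constants $\beta_1\ge0$ and $\beta_2\ge1$ such that $$\|\nabla f_i(x)\|^2\le\beta_1+\beta_2\|\nabla f(x)\|^2\quad\text{for all }x\in\mathbb{R}^n\text{ and } i=1,\dots,M.$$ Let $(\mathcal{B}_k)_{k\ge0}$ be any sequence of nonempty subsets of $\{1,\dots,M\}$ such that $$\frac{M-|\mathcal{B}_k|}{M}=\mathcal{O}(\gamma^{k/2})$$ for some $\gamma\in(0,1)$. Let $x_0\in\mathbb{R}^n$ and $$x_{k+1}=x_k-\frac1L g_k,\qquad g_k=\frac{1}{|\mathcal{B}_k|}\sum_{i\in\mathcal{B}_k}\nabla f_i(x_k),\qquad k\ge0.$$ Then for every $\epsilon>0$, $$f(x_k)-f(x_* )=[f(x_0)-f(x_* )]\,\mathcal{O}\big([1-\mu/L+\epsilon]^k\big)+\mathcal{O}(\sigma^k),\qquad \sigma=\max\{\gamma,\,1-\mu/L\}+\epsilon,$$ that is, there are constants $K_1,K_2\ge0$, independent of $k$, such that $f(x_k)-f(x_* )\le K_1[f(x_0)-f(x_* )](1-\mu/L+\epsilon)^k+K_2\sigma^k$ for all $k\ge0$.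
   Context: $\|\cdot\|$ is the Euclidean norm on $\mathbb{R}^n$ and $|\mathcal{B}|$ is the cardinality of $\mathcal{B}$. Lipschitz continuity of the gradient with constant $L$ means $\|\nabla f(x)-\nabla f(y)\|\le L\|x-y\|$ for all $x,y\in\mathbb{R}^n$. Strong convexity with parameter $\mu$ means $f(y)\ge f(x)+(y-x)^T\nabla f(x)+\frac{\mu}{2}\|y-x\|^2$ for all $x,y\in\mathbb{R}^n$. All $\mathcal{O}(\cdot)$ statements are in the iteration index $k$. The samples $\mathcal{B}_k$ may be chosen in any manner. *)

(* Defs.v *)
From mathcomp Require Import all_boot all_order all_algebra.
From mathcomp Require Import all_classical all_reals all_analysis.

Set Implicit Arguments.
Unset Strict Implicit.
Unset Printing Implicit Defensive.

Import Order.TTheory GRing.Theory Num.Theory.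
Import numFieldNormedType.Exports.

Local Open Scope ring_scope.

Section Euclidean.
Context {R : realType} {n : nat}.
Implicit Types (u v x y : 'rV[R]_n) (f : 'rV[R]_n -> R).

Definition dot u v : R := \sum_j u 0 j * v 0 j.

(* The library norm `|u| on 'rV[R]_n is the max norm, hence this definition. *)
Definition enorm u : R := Num.sqrt (dot u u).

(* Vector of partial derivatives: it represents 'd f x only where f is
   differentiable. *)
Definition grad f x : 'rV[R]_n := \row_j 'D_(delta_mx 0 j) f x.

(* The topology on 'rV[R]_n comes from the max norm; it is the Euclidean one. *)
Definition continuously_differentiable f : Prop :=
  (forall x, differentiable f x) /\ continuous (grad f).

Definition lipschitz_gradient (L : R) f : Prop :=
  forall x y, enorm (grad f x - grad f y) <= L * enorm (x - y).

Definition strongly_convex (mu : R) f : Prop :=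
  forall x y,
    f x + dot (y - x) (grad f x) + mu / 2 * enorm (y - x) ^+ 2 <= f y.

Definition minimizer f x : Prop := forall y, f x <= f y.

End Euclidean.

Section FiniteSum.
Context {R : realType} {n M : nat}.
Implicit Types fs : 'I_M -> 'rV[R]_n -> R.

Definition average fs (x : 'rV[R]_n) : R := M%:R^-1 * \sum_i fs i x.

Definition sampled_grad fs (B : {set 'I_M}) (x : 'rV[R]_n) : 'rV[R]_n :=
  #|B|%:R^-1 *: \sum_(i in B) grad (fs i) x.

End FiniteSum.

(* Main.v *)
(** Write [r k = (M - #|B k|) / M], [u k = f (x k) - f xstar], and [e k] for the
    error of the sampled gradient. A step of length [1/L] with an inexact
    gradient gives [f (x k.+1) <= f (x k) - (|grad f|^2 - |e k|^2) / (2 L)].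
    Strong convexity bounds [|grad f|^2] below by [2 mu (u k)]; comparing the
    sampled and the full average gives
    [|e k|^2 <= 4 (r k)^2 (beta1 + beta2 |grad f|^2)], where
    [|grad f|^2 <= 2 L (u k)]. Hence
    [u k.+1 <= (1 - mu/L + 4 beta2 (r k)^2) (u k) + (2 beta1 / L) (r k)^2]
    with [(r k)^2 = O(gamma^k)], and the perturbation of the contraction factor
    is eventually below [eps/2]. *)

Require Import Defs.
From mathcomp Require Import all_boot all_order all_algebra.
From mathcomp Require Import all_classical all_reals all_analysis.
From mathcomp Require Import ring lra.

Set Implicit Arguments.
Unset Strict Implicit.
Unset Printing Implicit Defensive.

Import Order.TTheory GRing.Theory Num.Theory.
Import numFieldNormedType.Exports.

Local Open Scope classical_set_scope.
Local Open Scope ring_scope.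

(** * Euclidean inner product and norm *)

Section EuclideanSpace.
Context {R : realType} {n : nat}.
Implicit Types (u v w : 'rV[R]_n) (a : R).

Lemma dotC u v : dot u v = dot v u.
Proof. by apply: eq_bigr => j _; rewrite mulrC. Qed.

Lemma dotDl u v w : dot (u + v) w = dot u w + dot v w.
Proof. by rewrite -big_split; apply: eq_bigr => j _; rewrite mxE mulrDl. Qed.

Lemma dotZl a u w : dot (a *: u) w = a * dot u w.
Proof. by rewrite big_distrr; apply: eq_bigr => j _; rewrite mxE -mulrA. Qed.

Lemma dotDr u v w : dot u (v + w) = dot u v + dot u w.
Proof. by rewrite dotC dotDl !(dotC u). Qed.

Lemma dotZr a u w : dot u (a *: w) = a * dot u w.
Proof. by rewrite dotC dotZl dotC. Qed.

Lemma dotNl u w : dot (- u) w = - dot u w.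
Proof. by rewrite -scaleN1r dotZl mulN1r. Qed.

Lemma dotNr u w : dot u (- w) = - dot u w.
Proof. by rewrite dotC dotNl dotC. Qed.

Lemma dot0l u : dot 0 u = 0.
Proof. by rewrite -(scale0r u) dotZl mul0r. Qed.

Lemma dot0r u : dot u 0 = 0.
Proof. by rewrite dotC dot0l. Qed.

Definition dotE := (dotDl, dotDr, dotNl, dotNr, dotZl, dotZr).

Lemma dot_ge0 u : 0 <= dot u u.
Proof. by apply: sumr_ge0 => j _; rewrite -expr2 sqr_ge0. Qed.

Lemma dot_eq0 u : dot u u = 0 -> u = 0.
Proof.
move=> /eqP; rewrite psumr_eq0 => [/allP u0|j _]; last by rewrite -expr2 sqr_ge0.
apply/rowP => j; rewrite mxE; apply/eqP.
by have /(_ (mem_index_enum j)) := u0 j; rewrite mulf_eq0 orbb.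
Qed.

Lemma enorm_ge0 u : 0 <= enorm u.
Proof. exact: sqrtr_ge0. Qed.

Lemma sqr_enorm u : enorm u ^+ 2 = dot u u.
Proof. by rewrite sqr_sqrtr// dot_ge0. Qed.

Lemma enorm0 : enorm (0 : 'rV[R]_n) = 0.
Proof. by rewrite /enorm dot0l sqrtr0. Qed.

Lemma enorm_eq0 u : enorm u = 0 -> u = 0.
Proof. by move=> u0; apply: dot_eq0; rewrite -sqr_enorm u0 expr0n. Qed.

Lemma enormZ a u : enorm (a *: u) = `|a| * enorm u.
Proof.
by rewrite /enorm dotZl dotZr mulrA -expr2 sqrtrM ?sqr_ge0// sqrtr_sqr.
Qed.

Lemma enormN u : enorm (- u) = enorm u.
Proof. by rewrite -scaleN1r enormZ normrN1 mul1r. Qed.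

(** Cauchy-Schwarz: expand the squared norm of [enorm v *: u - enorm u *: v] and cancel the factor
    [enorm u * enorm v]; the cases where it vanishes are treated apart. *)
Lemma dot_le_enorm u v : dot u v <= enorm u * enorm v.
Proof.
have [u0|u0] := eqVneq (enorm u) 0.
  by rewrite (enorm_eq0 u0) dot0l mulr_ge0// enorm_ge0.
have [v0|v0] := eqVneq (enorm v) 0.
  by rewrite (enorm_eq0 v0) dot0r mulr_ge0// enorm_ge0.
have u_gt0 : 0 < enorm u by rewrite lt_def u0 enorm_ge0.
have v_gt0 : 0 < enorm v by rewrite lt_def v0 enorm_ge0.
rewrite -(ler_pM2l (mulr_gt0 u_gt0 v_gt0)).
have := dot_ge0 (enorm v *: u - enorm u *: v).
rewrite !dotE (dotC v u) -!sqr_enorm; lra.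
Qed.

Lemma ler_enormD u v : enorm (u + v) <= enorm u + enorm v.
Proof.
rewrite -(ler_pXn2r (n := 2))// ?nnegrE ?addr_ge0 ?enorm_ge0//.
rewrite sqrrD !sqr_enorm !dotE (dotC v u).
have := dot_le_enorm u v; lra.
Qed.

Lemma ler_enorm_sum (I : finType) (P : {pred I}) (F : I -> 'rV[R]_n) (c : R) :
  (forall i, P i -> enorm (F i) <= c) ->
  enorm (\sum_(i | P i) F i) <= #|P|%:R * c.
Proof.
move=> Fc; rewrite -sum1_card natr_sum mulr_suml.
elim/big_rec2: _ => [|i r s Pi IH]; first by rewrite enorm0.
by rewrite (le_trans (ler_enormD _ _))// lerD// mul1r Fc.
Qed.

End EuclideanSpace.

(** * Descent and gradient-domination inequalities *)

Section Gradient.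
Context {R : realType} {n : nat}.
Implicit Types (f : 'rV[R]_n -> R) (x y d : 'rV[R]_n).

Lemma derive_grad f x d : differentiable f x -> 'D_d f x = dot d (grad f x).
Proof.
move=> df; rewrite deriveE// {1}[d]row_sum_delta linear_sum /=.
by apply: eq_bigr => j _; rewrite linearZ /= mxE deriveE.
Qed.

Lemma is_derive_line f x d (t : R) :
  differentiable f (x + t *: d) ->
  is_derive t (1 : R) (fun s : R => f (x + s *: d)) (dot d (grad f (x + t *: d))).
Proof.
move=> df; rewrite -derive_grad//.
(* The difference quotient along the line, taken at [t], is that of [f] at [x + t *: d] in direction
   [d]. *)
have fE : (fun h : R => h^-1 *: (((fun s : R => f (x + s *: d)) \o shift t)
                                  (h *: (1 : R)) - f (x + t *: d))) =
          (fun h : R => h^-1 *: ((f \o shift (x + t *: d)) (h *: d)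
                                  - f (x + t *: d))).
  apply/funext => h /=; congr (_ *: (f _ - _)).
  by rewrite -[h *: 1]/(h * 1) mulr1 scalerDl addrCA.
split; first by rewrite /derivable fE; exact: diff_derivable.
by rewrite /derive fE.
Qed.

(** The mean value theorem on the segment from [x] to [y], applied to [f] minus its quadratic model,
    does the work of integrating the gradient. *)
Lemma lipschitz_gradient_ub (L : R) f x y :
  (forall z, differentiable f z) -> lipschitz_gradient L f ->
  f y <= f x + dot (y - x) (grad f x) + L / 2 * enorm (y - x) ^+ 2.
Proof.
move=> df lipf; set d := y - x.
pose c : R := L / 2 * enorm d ^+ 2.
(* The goal amounts to [phi 1 <= phi 0], so a nonpositive derivative on [[0, 1]] is enough. *)
pose phi (t : R) : R := f (x + t *: d) - (t * dot d (grad f x) + t ^+ 2 * c).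
pose dphi (t : R) : R :=
  dot d (grad f (x + t *: d)) - (dot d (grad f x) + 2 * t * c).
have phi' (t : R) : is_derive t (1 : R) phi (dphi t).
  apply: is_deriveB; first exact: is_derive_line.
  have -> : (fun s : R => s * dot d (grad f x) + s ^+ 2 * c) =
    dot d (grad f x) \*: (id : R -> R) + c \*: ((id : R -> R) ^+ 2).
    apply/funext => s; rewrite !fctE /= /GRing.scale /=; ring.
  apply: is_derive_eq; rewrite /GRing.scale /=; ring.
have [|t] := @MVT_segment R phi dphi 0 1 ler01 (fun t _ => phi' t).
  by apply: derivable_within_continuous => t _; exact: (@ex_derive _ _ _ _ _ _ _ (phi' t)).
rewrite in_itv /= => /andP[t0 t1] phiE.
(* By Cauchy-Schwarz and the Lipschitz bound, the gradient difference contributes at most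
   [L * t * enorm d ^+ 2], which is [2 * t * c]. *)
have : dphi t <= 0.
  have := dot_le_enorm d (grad f (x + t *: d) - grad f x).
  have := lipf (x + t *: d) x.
  rewrite (addrC x) addrK -(addrC x) enormZ ger0_norm// => /(ler_wpM2l (enorm_ge0 d)).
  rewrite /dphi /c dotDr dotNr; lra.
have xd : x + d = y by rewrite addrC subrK.
move: phiE; rewrite /phi scale0r addr0 scale1r xd /c; lra.
Qed.

(* The descent inequality along an inexact gradient step: completing the
   square leaves the error [g - grad f x] as the only positive term. *)
Lemma inexact_gradient_step (L : R) f x g : 0 < L ->
  (forall z, differentiable f z) -> lipschitz_gradient L f ->
  f (x - L^-1 *: g) <= f x - (2 * L)^-1 * enorm (grad f x) ^+ 2
                       + (2 * L)^-1 * enorm (g - grad f x) ^+ 2.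
Proof.
move=> L0 df /(lipschitz_gradient_ub x (x - L^-1 *: g) df).
move=> /le_trans; apply; rewrite [x - _]addrC addrK !sqr_enorm !dotE.
rewrite (dotC (grad f x) g) le_eqVlt; apply/orP; left; apply/eqP.
by field; rewrite gt_eqF.
Qed.

(** An exact gradient step from [x] decreases [f] by at least [enorm (grad f x) ^+ 2 / (2 * L)] and
    cannot go below the minimum. *)
Lemma sqr_grad_le (L : R) f x xstar : 0 < L ->
  (forall z, differentiable f z) -> lipschitz_gradient L f ->
  minimizer f xstar ->
  enorm (grad f x) ^+ 2 <= 2 * L * (f x - f xstar).
Proof.
move=> L0 df lipf minf.
have := le_trans (minf _) (inexact_gradient_step x (grad f x) L0 df lipf).
rewrite subrr enorm0 expr0n mulr0 addr0 => h.
have L20 : 0 < 2 * L by lra.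
by rewrite -ler_pdivrMl//; lra.
Qed.

(** Polyak-Lojasiewicz inequality: the strong convexity lower bound, as a quadratic in [y - x], is
    smallest at [- mu^-1 *: grad f x]. Completing the square there uses
    [mu *: (y - x) + grad f x]. *)
Lemma strongly_convex_grad_ge (mu : R) f x y : 0 < mu -> strongly_convex mu f ->
  2 * mu * (f x - f y) <= enorm (grad f x) ^+ 2.
Proof.
move=> mu0 /(_ x y).
have := dot_ge0 (mu *: (y - x) + grad f x).
rewrite !sqr_enorm !(dotDl (mu *: _)) !(dotDr _ (mu *: _)) !dotZl !dotZr.
rewrite (dotC (grad f x) (y - x)).
set p := dot (y - x) (y - x); set q := dot (y - x) _; set r := dot _ _.
move=> h0 h1.
have : mu * (f x + q + mu / 2 * p) <= mu * f y by rewrite ler_pM2l.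
lra.
Qed.

End Gradient.

(** * Error of the sampled gradient *)

Section SampledGradient.
Context {R : realType} {n M : nat}.
Variable fs : 'I_M -> 'rV[R]_n -> R.

Lemma averageE : average fs = M%:R^-1 \*: \sum_i fs i.
Proof. by apply/funext => y; rewrite /average /= fct_sumE. Qed.

Lemma differentiable_average y :
  (forall i, differentiable (fs i) y) -> differentiable (average fs) y.
Proof.
move=> dfs; rewrite averageE; apply: differentiableZ.
exact: differentiable_sum.
Qed.

Lemma grad_average y : (forall i, differentiable (fs i) y) ->
  grad (average fs) y = M%:R^-1 *: \sum_i grad (fs i) y.
Proof.
move=> dfs; apply/rowP => j; rewrite !mxE summxE averageE.
have dfsj i : derivable (fs i) y (delta_mx 0 j) by exact: diff_derivable.
rewrite deriveZ; last by apply: derivable_sum.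
by rewrite derive_sum//; congr (_ * _); apply: eq_bigr => i _; rewrite mxE.
Qed.

(** Sampling raises the weight of each index in [S] by [1 / #|S| - 1 / M] and lowers that of every
    other index by [1 / M]. Either group contributes at most [(M - #|S|) / M * c], whence the factor
    2. *)
Lemma sampled_grad_error (S : {set 'I_M}) y (c : R) :
  S != finset.set0 -> (forall i, differentiable (fs i) y) ->
  (forall i, enorm (grad (fs i) y) <= c) ->
  enorm (sampled_grad fs S y - grad (average fs) y)
    <= 2 * ((M%:R - #|S|%:R) / M%:R) * c.
Proof.
move=> S0 dfs fsc; rewrite grad_average// (bigID (mem S)) /=.
have S_gt0 : 0 < #|S|%:R :> R by rewrite ltr0n card_gt0.
have leSM : #|S|%:R <= M%:R :> R.
  by rewrite ler_nat -[X in (_ <= X)%N]card_ord max_card.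
have M_gt0 : 0 < M%:R :> R by exact: lt_le_trans leSM.
set s := \sum_(i in S) _; set t := \sum_(i | _) _.
have -> : sampled_grad fs S y - M%:R^-1 *: (s + t) =
          (#|S|%:R^-1 - M%:R^-1) *: s - M%:R^-1 *: t.
  by rewrite /sampled_grad -/s scalerDr scalerBl opprD addrA.
have s_le : enorm s <= #|S|%:R * c by apply: ler_enorm_sum.
have t_le : enorm t <= (M%:R - #|S|%:R) * c.
  apply: (le_trans (ler_enorm_sum (P := fun i => i \notin S) (c := c) _)) => //.
  by rewrite -[X in X%:R - _](card_ord M) -(cardC (mem S)) natrD addrC addKr.
have w_ge0 : 0 <= #|S|%:R^-1 - M%:R^-1 :> R.
  by rewrite subr_ge0 lef_pV2 ?posrE.
have Mi_ge0 : 0 <= M%:R^-1 :> R by rewrite invr_ge0 ltW.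
apply: (le_trans (ler_enormD _ _)); rewrite enormN !enormZ !ger0_norm//.
have := lerD (ler_wpM2l w_ge0 s_le) (ler_wpM2l Mi_ge0 t_le).
move=> /le_trans; apply; rewrite le_eqVlt; apply/orP; left; apply/eqP.
by field; rewrite !gt_eqF.
Qed.

End SampledGradient.

(** * Geometric rates for perturbed recursions *)

(* The gap [e] between the contraction factor and [s] absorbs the geometric
   forcing term once [K * e >= D]. *)
Lemma perturbed_geometric_bound (R : realType) (u : nat -> R) (g s e D : R)
    (N : nat) :
  0 < g -> g <= s -> 0 < e -> e <= s -> 0 <= D ->
  (forall k, (N <= k)%N -> u k.+1 <= (s - e) * u k + D * g ^+ k) ->
  exists2 K, 0 <= K & forall k, u k <= K * s ^+ k.
Proof.
move=> g0 gs e0 es D0 rec; have s0 : 0 < s by exact: lt_le_trans gs.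
(* [T] dominates each ratio [u i / s ^+ i] with [i <= N], which covers the indices that the
   recursion does not control. *)
pose T := \sum_(i < N.+1) `|u i| / s ^+ i.
have T0 : 0 <= T by apply: sumr_ge0 => i _; rewrite divr_ge0// exprn_ge0// ltW.
have De0 : 0 <= D / e by rewrite divr_ge0// ltW.
have init k : (k <= N)%N -> u k <= (D / e + T) * s ^+ k.
  move=> kN; rewrite -ler_pdivrMr ?exprn_gt0//.
  rewrite /T (bigD1 (Ordinal (kN : (k < N.+1)%N)))//=.
  rewrite -[leLHS]add0r lerD//; rewrite -[leLHS]addr0 lerD//.
    by rewrite ler_pM2r ?invr_gt0 ?exprn_gt0// ler_norm.
  by apply: sumr_ge0 => i _; rewrite divr_ge0// exprn_ge0// ltW.
exists (D / e + T) => [|k]; first exact: addr_ge0.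
elim: k => [|k IH]; first exact: init.
have [kN|Nk] := leqP k.+1 N; first exact: init.
have gsk : g ^+ k <= s ^+ k by rewrite lerXn2r// nnegrE ltW.
have se0 : 0 <= s - e by rewrite subr_ge0.
apply: (le_trans (rec _ _)) => //.
apply: (le_trans (lerD (ler_wpM2l se0 IH) (ler_wpM2l D0 gsk))).
have DE : D = e * (D / e) by field; rewrite gt_eqF.
rewrite exprS [X in _ + X * _]DE.
have : 0 <= e * (T * s ^+ k).
  by rewrite !mulr_ge0// ?exprn_ge0// ltW.
set p := s ^+ k; set q := D / e; lra.
Qed.

(** Squaring clears the half exponent, turning the real power of [gamma] into an integer power and
    the constant into its square. *)
Lemma bigO_powR_half_sqr (R : realType) (gamma : R) (r : nat -> R) :
  0 <= gamma ->
  r =O_\oo (fun k : nat => gamma `^ (k%:R / 2)) ->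
  exists2 C, 0 < C & exists N, forall k, (N <= k)%N ->
    r k ^+ 2 <= C * gamma ^+ k.
Proof.
move=> g0 /eqO_exP[C C0 [N _ NC]]; exists (C ^+ 2); first exact: exprn_gt0.
exists N => k /NC /= rk.
have -> : gamma ^+ k = `|gamma `^ (k%:R / 2)| ^+ 2.
  rewrite ger0_norm ?powR_ge0// -[RHS]powR_mulrn ?powR_ge0// -powRrM.
  by rewrite divfK ?pnatr_eq0// powR_mulrn.
by rewrite -exprMn -(real_normK (num_real (r k))) lerXn2r ?nnegrE// mulr_ge0// ltW.
Qed.

Lemma small_geometric (R : realType) (gamma C e : R) :
  0 < gamma -> gamma < 1 -> 0 < C -> 0 < e ->
  exists N, forall k, (N <= k)%N -> C * gamma ^+ k <= e.
Proof.
move=> g0 g1 C0 e0.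
have /cvgrPdist_le /(_ (e / C)) : gamma ^+ k @[k --> \oo] --> (0 : R).
  by apply: cvg_expr; rewrite gtr0_norm.
move=> /(_ (divr_gt0 e0 C0))[N _ Ne]; exists N => k /Ne /=.
by rewrite sub0r normrN gtr0_norm ?exprn_gt0// ler_pdivlMr// mulrC.
Qed.

(** * Convergence of the sampled gradient iteration *)

Theorem theorem3p1 (R : realType) (n M : nat) (fs : 'I_M -> 'rV[R]_n -> R)
    (xstar : 'rV[R]_n) (L mu beta1 beta2 gamma : R)
    (B : nat -> {set 'I_M}) (x : nat -> 'rV[R]_n) :
  let f := average fs in
  (forall i, continuously_differentiable (fs i)) ->
  minimizer f xstar ->
  0 < L -> lipschitz_gradient L f ->
  0 < mu -> strongly_convex mu f ->
  0 <= beta1 -> 1 <= beta2 ->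
  (forall y i, enorm (grad (fs i) y) ^+ 2
               <= beta1 + beta2 * enorm (grad f y) ^+ 2) ->
  (forall k, B k != finset.set0) ->
  0 < gamma -> gamma < 1 ->
  (fun k : nat => (M%:R - #|B k|%:R) / M%:R : R)
    =O_\oo (fun k : nat => gamma `^ (k%:R / 2)) ->
  (forall k, x k.+1 = x k - L^-1 *: sampled_grad fs (B k) (x k)) ->
  forall eps : R, 0 < eps ->
  let sigma := Num.max gamma (1 - mu / L) + eps in
  exists K1 K2 : R, [/\ 0 <= K1, 0 <= K2 &
    forall k : nat,
      f (x k) - f xstar
        <= K1 * (f (x 0%N) - f xstar) * (1 - mu / L + eps) ^+ k
           + K2 * sigma ^+ k].
Proof.
move=> f fsC1 minf L0 lipf mu0 scf beta1_ge0 beta2_ge1 fs_le B0 gamma0 gamma1.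
move=> rO xS eps eps0 sigma.
have dfs i y : differentiable (fs i) y by case: (fsC1 i).
have df y : differentiable f y by exact: differentiable_average.
pose u k := f (x k) - f xstar.
have u_ge0 k : 0 <= u k by rewrite subr_ge0.
have [C C0 [N1 rC]] := bigO_powR_half_sqr (ltW gamma0) rO.
set r := (fun k : nat => (M%:R - #|B k|%:R) / M%:R : R) in rC.
have beta2_gt0 : 0 < beta2 by exact: lt_le_trans beta2_ge1.
have step k : u k.+1 <= (1 - mu / L + 4 * beta2 * r k ^+ 2) * u k
                       + 2 * beta1 / L * r k ^+ 2.
  set G := enorm (grad f (x k)) ^+ 2.
  have c_ge0 : 0 <= beta1 + beta2 * G by rewrite addr_ge0// mulr_ge0 ?sqr_ge0// ltW.
  have c_le i : enorm (grad (fs i) (x k)) <= Num.sqrt (beta1 + beta2 * G).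
    by rewrite -[leLHS](ger0_norm (enorm_ge0 _)) -sqrtr_sqr ler_wsqrtr.
  have := sampled_grad_error (B0 k) (fun i => dfs i (x k)) c_le.
  rewrite -/f -/(r k) => err.
  have {}err : enorm (sampled_grad fs (B k) (x k) - grad f (x k)) ^+ 2
               <= 4 * r k ^+ 2 * (beta1 + beta2 * G).
    rewrite -[X in _ <= _ * X](sqr_sqrtr c_ge0).
    have -> : 4 * r k ^+ 2 = (2 * r k) ^+ 2 by ring.
    rewrite -exprMn lerXn2r// ?nnegrE ?enorm_ge0//.
    exact: le_trans (enorm_ge0 _) err.
  (* The two bounds on [G] serve different terms: [Gmu] turns the decrease into the contraction
     [mu / L], while [GL] turns the [beta2] part of the error into a perturbation of it. *)
  have GL : G <= 2 * L * u k := sqr_grad_le (x k) L0 df lipf minf.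
  have Gmu : 2 * mu * u k <= G := strongly_convex_grad_ge (x k) xstar mu0 scf.
  have := inexact_gradient_step (x k) (sampled_grad fs (B k) (x k)) L0 df lipf.
  rewrite -xS -/G => dec.
  have L2_ge0 : 0 <= (2 * L)^-1 by rewrite invr_ge0 mulr_ge0// ltW.
  have := ler_wpM2l L2_ge0 err; have := ler_wpM2l L2_ge0 Gmu.
  have rb_ge0 : 0 <= (2 * L)^-1 * (4 * r k ^+ 2 * beta2).
    by rewrite mulr_ge0// mulr_ge0 ?(ltW beta2_gt0)// mulr_ge0// sqr_ge0.
  have := ler_wpM2l rb_ge0 GL.
  have -> : (2 * L)^-1 * (4 * r k ^+ 2 * beta2) * (2 * L * u k) =
            4 * beta2 * r k ^+ 2 * u k by field; rewrite gt_eqF.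
  have -> : (2 * L)^-1 * (2 * mu * u k) = mu / L * u k by field; rewrite gt_eqF.
  have -> : 2 * beta1 / L * r k ^+ 2 = (2 * L)^-1 * (4 * r k ^+ 2 * beta1).
    by field; rewrite gt_eqF.
  move: dec; rewrite /u; lra.
have bC0 : 0 < 4 * beta2 * C by rewrite !mulr_gt0.
(* Half of [eps] absorbs the perturbation [4 * beta2 * r k ^+ 2]; the other half is the gap between
   the resulting factor and [sigma]. *)
have e0 : 0 < eps / 2 by lra.
have [N2 small] := small_geometric gamma0 gamma1 bC0 e0.
have max_ge1 : gamma <= Num.max gamma (1 - mu / L) by rewrite le_max lexx.
have max_ge2 : 1 - mu / L <= Num.max gamma (1 - mu / L) by rewrite le_max lexx orbT.
have bL_ge0 : 0 <= 2 * beta1 / L by rewrite divr_ge0 ?mulr_ge0// ltW.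
have D_ge0 : 0 <= 2 * beta1 / L * C by rewrite mulr_ge0// ltW.
have [||k|K K0 uK] := @perturbed_geometric_bound R u gamma sigma (eps / 2)
  (2 * beta1 / L * C) (maxn N1 N2) gamma0 _ e0 _ D_ge0; rewrite /sigma; try lra.
  rewrite geq_max => /andP[/rC rk /small gk].
  apply: (le_trans (step k)); apply: lerD; last by rewrite -(mulrA _ C) ler_wpM2l.
  rewrite ler_wpM2r//.
  have : 4 * beta2 * r k ^+ 2 <= 4 * beta2 * C * gamma ^+ k.
    by rewrite -(mulrA _ C) ler_wpM2l// mulr_ge0// ltW.
  lra.
(* Since [1 - mu / L + eps <= sigma], the [sigma ^+ k] term alone suffices. *)
exists 0, K; split=> // k; rewrite !mul0r add0r; exact: uK.
Qed.
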